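(* Let $M$ be a finite-$\mathcal{J}$-above finitely presented inverse monoid, let $A$ be a finite alphabet, let $\varphi:A^*\to M$ be a homomorphism, and let $L\subseteq A^*$ be a language such that for any rational language $R$ in $A^*$ (given by a finite automaton) it is decidable whether $L\cap R$ is empty or not. Then the membership problem for $\varphi(L)$ is decidable in $M$.
   Context: A monoid $M$ is inverse if for every $a\in M$ there is a unique $b\in M$ with $aba=a$ and $bab=b$ (denoted $b=a^{-1}$). For a set $B$ put $\widetilde{B}=B\cup B^{-1}$, with $B^{-1}$ a set of formal inverses, and extend $^{-1}$ to an involution of the free monoid $\widetilde{B}^*$ by $1^{-1}=1$, $(uv)^{-1}=v^{-1}u^{-1}$. Let $\rho_B$ be the congruence on $\widetilde{B}^*$ generated by all pairs $(ww^{-1}w,w)$ and $(uu^{-1}vv^{-1},vv^{-1}uu^{-1})$ with $u,v,w\in\widetilde{B}^*$. The inverse monoid defined by the presentation $\mathrm{Inv}\langle B\mid S\rangle$, $S\subseteq\widetilde{B}^*\times\widetilde{B}^*$, is $\widetilde{B}^*/(\rho_B\cup S)^\sharp$, where $^\sharp$ denotes the generated congruence. ''Finitely presented inverse monoid'' means an inverse monoid having a presentation $\mathrm{Inv}\langle B\mid S\rangle$ with $B,S$ finite (not necessarily a finite monoid presentation). For $u,v\in M$, $u$ is a factor of $v$ if $v=xuy$ for some $x,y\in M$. $M$ is finite-$\mathcal{J}$-above if every element of $M$ has only finitely many factors. A language over $A$ is rational if it is recognized by a finite $A$-automaton. The membership problem for a subset $T\subseteq M$ asks for an algorithm that, given an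 element $g\in M$ (as a word in the generators and their inverses), decides whether $g\in T$. *)

(* Defs.v *)
From HB Require Import structures.
From mathcomp Require Import all_boot.
From mathcomp Require Import boolp classical_sets functions cardinality.

Set Implicit Arguments.
Unset Strict Implicit.
Unset Printing Implicit Defensive.

Local Open Scope group_scope.
Local Open Scope classical_set_scope.

(* The free monoid X^*. *)
Definition word (X : Type) : Type := seq X.

HB.instance Definition _ (X : choiceType) := Choice.on (word X).
HB.instance Definition _ (X : choiceType) :=
  isMonoid.Build (word X) (@catA X) (@cat0s X) (@cats0 X).

Definition inverse_monoid (M : monoidType) : Prop :=
  forall a : M, exists! b : M, a * b * a = a /\ b * a * b = b.

Definition factor (M : monoidType) (u v : M) : Prop :=
  exists x y : M, v = x * u * y.

Definition finite_J_above (M : monoidType) : Prop :=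
  forall v : M, finite_set [set u : M | factor u v].

Inductive congruence_gen (M : monoidType) (r : M -> M -> Prop) :
    M -> M -> Prop :=
| cg_base x y : r x y -> congruence_gen r x y
| cg_refl x : congruence_gen r x x
| cg_sym x y : congruence_gen r x y -> congruence_gen r y x
| cg_trans x y z :
    congruence_gen r x y -> congruence_gen r y z -> congruence_gen r x z
| cg_mul x y x' y' :
    congruence_gen r x y -> congruence_gen r x' y' ->
    congruence_gen r (x * x') (y * y').

Section InversePresentations.

Variable B : finType.

(* [inl b] is the generator b, and [inr b] is its formal inverse. *)
Definition letter : finType := (B + B)%type.

Definition letter_inv (x : letter) : letter :=
  match x with inl b => inr b | inr b => inl b end.

Definition word_inv (w : word letter) : word letter := rev (map letter_inv w).

Inductive inverse_law : word letter -> word letter -> Prop :=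
| inverse_law_regular w : inverse_law (w * word_inv w * w) w
| inverse_law_idem u v :
    inverse_law (u * word_inv u * v * word_inv v)
                (v * word_inv v * u * word_inv u).

Definition rho : word letter -> word letter -> Prop :=
  congruence_gen inverse_law.

Definition inv_congruence (S : seq (word letter * word letter)) :
    word letter -> word letter -> Prop :=
  congruence_gen (fun u v => rho u v \/ (u, v) \in S).

(* M is the inverse monoid Inv<B | S>: the homomorphism pi induces an
   isomorphism from the quotient of the free monoid onto M. *)
Definition inv_presentation (S : seq (word letter * word letter))
    (M : monoidType) (pi : UMagmaMorphism.type (word letter) M) :
    Prop :=
  (forall m : M, exists w, pi w = m) /\
  (forall u v, pi u = pi v <-> inv_congruence S u v).

End InversePresentations.

(* A nondeterministic finite automaton over A, with states 0, ..., n-1; the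
   three sequences are read as the finite sets of their entries. *)
Record automaton (A : finType) := Automaton {
  nstates : nat;
  initial : seq 'I_nstates;
  terminal : seq 'I_nstates;
  edges : seq ('I_nstates * A * 'I_nstates)
}.

Fixpoint run (A : finType) (N : automaton A) (p : 'I_(nstates N)) (w : word A)
    (q : 'I_(nstates N)) : Prop :=
  match w with
  | [::] => p = q
  | a :: w' => exists2 r, (p, a, r) \in edges N & run r w' q
  end.

Definition recognized (A : finType) (N : automaton A) : set (word A) :=
  [set w | exists p q, [/\ p \in initial N, q \in terminal N & run p w q]].

(* The total recursive functions: the least class of functions on tuples of
   natural numbers containing the constant 0, the successor and the
   projections, and closed under composition, primitive recursion and
   minimization of regular functions (those for which the minimum is always
   defined).  Rocq functions are not restricted a priori to computable ones:
   with the classical axioms, every predicate has a boolean test. *)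
Inductive recursive : forall n, (n.-tuple nat -> nat) -> Prop :=
| rec_zero n : recursive (fun _ : n.-tuple nat => 0%N)
| rec_succ : recursive (fun t : 1.-tuple nat => (thead t).+1)
| rec_proj n (i : 'I_n) : recursive (fun t : n.-tuple nat => tnth t i)
| rec_comp n m (f : m.-tuple nat -> nat) (g : 'I_m -> n.-tuple nat -> nat) :
    recursive f -> (forall i, recursive (g i)) ->
    recursive (fun t : n.-tuple nat => f [tuple g i t | i < m])
| rec_prim n (f : n.-tuple nat -> nat) (g : n.+2.-tuple nat -> nat) :
    recursive f -> recursive g ->
    recursive (fun t : n.+1.-tuple nat =>
      nat_rect (fun _ => nat) (f [tuple of behead t])
        (fun k r => g [tuple of k :: r :: behead t]) (thead t))
| rec_min n (f : n.+1.-tuple nat -> nat) (g : n.-tuple nat -> nat) :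
    recursive f ->
    (forall t : n.-tuple nat, f [tuple of g t :: t] = 0%N /\
       forall k, (k < g t)%N -> f [tuple of k :: t] <> 0%N) ->
    recursive g
| rec_ext n (f g : n.-tuple nat -> nat) :
    f =1 g -> recursive f -> recursive g.

(* The instances x of the problem "does P hold of x?" are presented to the
   algorithm by their Goedel numbers. *)
Definition decidable_problem (X : Type) (code : X -> nat) (P : X -> Prop) :
    Prop :=
  exists2 f : 1.-tuple nat -> nat, recursive f &
    forall x, P x <-> f [tuple code x] = 1%N.

(* The letters of a finite alphabet are numbered by [enum_rank]; any other
   numbering differs from it by a finite permutation. [CodeSeq.code] is the
   library's (primitive recursive) bijection from [seq nat] to [nat]. *)
Definition word_code (X : finType) (w : word X) : nat :=
  CodeSeq.code [seq nat_of_ord (enum_rank x) | x <- w].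

Definition automaton_code (A : finType) (N : automaton A) : nat :=
  CodeSeq.code
    [:: nstates N;
        CodeSeq.code (map val (initial N));
        CodeSeq.code (map val (terminal N));
        CodeSeq.code
          [seq CodeSeq.code
                 [:: val e.1.1; val (enum_rank e.1.2); val e.2] | e <- edges N]].

(* Emptiness of the intersection of L with a rational language, the latter
   being given by a finite automaton. *)
Definition rational_emptiness_decidable (A : finType) (L : set (word A)) :
    Prop :=
  decidable_problem (@automaton_code A)
    (fun N => L `&` recognized N = set0).

(* The elements of M are given by words over the generators and their formal
   inverses, evaluated by pi. *)
Definition membership_decidable (B : finType) (M : monoidType)
    (pi : word (letter B) -> M) (T : set M) : Prop :=
  decidable_problem (@word_code (letter B)) (fun w => T (pi w)).

(* Main.v *)
(* Let m be the element of M given by the input word.  Its set P of left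
   divisors is finite because M is finite-J-above, so phi^-1(m) is recognized
   by the automaton with states P and edges p -a-> p phi(a), and m belongs to
   phi(L) if and only if L meets this rational language.  Since x divides m on
   the left if and only if x x^-1 m = m, an automaton can be recognized as
   correct by equalities and inequalities of words in M, so that unbounded
   search finds one as soon as both relations are recursively enumerable.
   Equality is, because the presentation is finite.  For u <> v the letters
   act by partial injections, s |-> s b whenever s b b^-1 = s, on the finite
   set of factors of u and v; this action respects the presentation, is given
   by a finite table, and separates u from v.  Conversely every finite action
   by partial injections satisfies the laws of inverse monoids, so it only has
   to be tested on the finitely many defining relations. *)
Require Import Defs.
From mathcomp Require Import all_boot.
From mathcomp Require Import boolp classical_sets functions cardinality.
From mathcomp Require Import zify.
From Stdlib Require Import Relations.

Set Implicit Arguments.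
Unset Strict Implicit.
Unset Printing Implicit Defensive.

(** * Recursive functions of one and two arguments *)

Definition rec1 (f : nat -> nat) : Prop :=
  recursive (fun t : 1.-tuple nat => f (tnth t ord0)).

Definition rec2 (f : nat -> nat -> nat) : Prop :=
  recursive (fun t : 2.-tuple nat => f (tnth t ord0) (tnth t ord_max)).

Lemma rec_ap1 n f (g : n.-tuple nat -> nat) :
  rec1 f -> recursive g -> recursive (fun t => f (g t)).
Proof.
move=> rf rg.
apply: (rec_ext (f := fun t => f (tnth [tuple g t | i < 1] ord0))).
  by move=> t; rewrite tnth_mktuple.
exact: (rec_comp rf (g := fun=> g)).
Qed.

Lemma rec_ap2 n f (g h : n.-tuple nat -> nat) :
  rec2 f -> recursive g -> recursive h -> recursive (fun t => f (g t) (h t)).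
Proof.
move=> rf rg rh; pose k (i : 'I_2) := if i == ord0 then g else h.
apply: (rec_ext (f := fun t => f (tnth [tuple k i t | i < 2] ord0)
                                 (tnth [tuple k i t | i < 2] ord_max))).
  by move=> t; rewrite !tnth_mktuple.
by apply: (rec_comp rf (g := k)) => i; rewrite /k; case: ifP.
Qed.

(** [rec_prim] recurses on the first component of its tuple. Composing it with the tuple of [m t]
    followed by [t] lets bound and start be arbitrary recursive functions of the same parameters. *)
Lemma rec_natrect n (a m : n.-tuple nat -> nat)
    (g : nat -> nat -> n.-tuple nat -> nat) :
  recursive a -> recursive m ->
  recursive (fun t : n.+2.-tuple nat =>
    g (tnth t ord0) (tnth t (lift ord0 ord0))
      [tuple tnth t (lift ord0 (lift ord0 i)) | i < n]) ->
  recursive (fun t => nat_rect (fun=> nat) (a t) (fun k r => g k r t) (m t)).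
Proof.
move=> ra rm; set F := (F in recursive F) => rg.
have FE p r (t : n.-tuple nat) : F [tuple of p :: r :: t] = g p r t.
  rewrite /F; congr (g _ _ _); apply: eq_from_tnth => i.
  by rewrite tnth_mktuple !tnthS.
pose k (i : 'I_n.+1) (t : n.-tuple nat) :=
  if unlift ord0 i is Some j then tnth t j else m t.
have kE t : [tuple k i t | i < n.+1] = [tuple of m t :: t].
  apply: eq_from_tnth => i; rewrite tnth_mktuple /k.
  by case: unliftP => [j|] ->; rewrite ?tnth0 ?tnthS.
apply: rec_ext (rec_comp (rec_prim ra rg) (g := k) _) => [t|i].
  rewrite kE theadE; have bt : [tuple of behead [tuple of m t :: t]] = t.
    exact: val_inj.
  suff natE q : nat_rect (fun=> nat) (a t)
      (fun p r => F [tuple of p :: r :: behead [tuple of m t :: t]]) q =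
      nat_rect (fun=> nat) (a t) (fun p r => g p r t) q by rewrite bt natE.
  elim: q => //= p ->; rewrite -FE; congr F; exact: val_inj.
rewrite /k; case: unliftP => [j|] _ //; exact: rec_proj.
Qed.

Lemma rec_natrect1 a (g : nat -> nat -> nat) :
  rec2 g -> rec1 (fun n => nat_rect (fun=> nat) a g n).
Proof.
move=> rg; apply: (rec_natrect (a := fun=> a) (g := fun k r _ => g k r)).
- by elim: a => [|a ra]; [exact: rec_zero | exact: (rec_ap1 (rec_succ) ra)].
- exact: rec_proj.
- exact: (rec_ap2 rg (rec_proj _) (rec_proj _)).
Qed.

Lemma rec_const n c : recursive (fun _ : n.-tuple nat => c).
Proof.
by elim: c => [|c rc]; [exact: rec_zero | exact: (rec_ap1 (rec_succ) rc)].
Qed.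

Lemma rec_pred : rec1 predn.
Proof.
apply: rec_ext (rec_natrect1 0 (g := fun k _ => k) (rec_proj _)) => t.
by case: (tnth t _).
Qed.

Lemma rec_double : rec1 double.
Proof.
apply: rec_ext (rec_natrect1 0 (g := fun _ r => r.+2) _) => [t|].
  by elim: (tnth t _) => //= n ->; rewrite doubleS.
apply: (rec_ap1 rec_succ); apply: (rec_ap1 rec_succ); exact: rec_proj.
Qed.

Lemma rec_iter (f : nat -> nat) : rec1 f -> rec2 (fun n x => iter n f x).
Proof.
move=> rf; apply: rec_ext (rec_natrect (a := fun t => tnth t ord_max)
  (m := fun t => tnth t ord0) (g := fun _ r _ => f r) _ _ _) => [t|||].
- by elim: (tnth t ord0) => //= n ->.
- exact: rec_proj.
- exact: rec_proj.
- exact: (rec_ap1 rf (rec_proj _)).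
Qed.

Lemma rec_sub : rec2 subn.
Proof.
apply: rec_ext (rec_ap2 (rec_iter rec_pred) (rec_proj ord_max) (rec_proj ord0)).
by move=> t; rewrite iter_predn.
Qed.

Lemma rec_half : rec1 half.
Proof.
(* The half of n is the least k with n <= 2k + 1. *)
apply: (rec_min (f := fun t => tnth t (lift ord0 ord0) - (tnth t ord0).*2.+1)).
  apply: (rec_ap2 rec_sub (rec_proj _)); apply: (rec_ap1 rec_succ).
  exact: (rec_ap1 rec_double (rec_proj _)).
move=> t; rewrite !tnthS !tnth0; set n := tnth t ord0.
split=> [|k ltk]; last rewrite !tnthS !tnth0 -/n;
  rewrite -{1}(odd_double_half n).
  by case: (odd n); lia.
case: (odd n) => /=; lia.
Qed.

Lemma rec_odd : rec1 odd.
Proof.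
apply: rec_ext (rec_ap2 rec_sub (rec_proj ord0)
  (rec_ap1 rec_double (rec_ap1 rec_half (rec_proj ord0)))) => t.
by rewrite -{1}(odd_double_half (tnth t ord0)) addnK.
Qed.

(* The code of the list [x :: s] is the successor of [pair_code x (code s)]. *)
Definition pair_code x y := (2 ^ x * y.*2.+1).-1.
(** If n codes (x, y), then n + 1 = 2^x (2y + 1): x is the 2-adic valuation of n + 1, and x + 1
    halvings of n + 1 leave y. *)
Definition code_fst n := logn 2 n.+1.
Definition code_snd n := (iter (code_fst n) half n.+1)./2.

Lemma pair_codeS x y : (pair_code x y).+1 = 2 ^ x * y.*2.+1.
Proof. by rewrite prednK // muln_gt0 expn_gt0. Qed.

Lemma iter_half k x y : k <= x -> iter k half (2 ^ x * y) = 2 ^ (x - k) * y.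
Proof.
elim: k => [|k IHk] le_kx /=; first by rewrite subn0.
by rewrite IHk 1?ltnW // -(subnSK le_kx) expnS -mulnA mul2n doubleK.
Qed.

Lemma code_fstK x y : code_fst (pair_code x y) = x.
Proof.
rewrite /code_fst pair_codeS lognM ?expn_gt0 // pfactorK //.
rewrite logn_coprime ?addn0 //.
by rewrite prime_coprime // dvdn2 /= odd_double.
Qed.

Lemma code_sndK x y : code_snd (pair_code x y) = y.
Proof.
rewrite /code_snd code_fstK pair_codeS iter_half // subnn mul1n.
by rewrite -[_.+1]/(true + y.*2) half_bit_double.
Qed.

Lemma pair_codeK n : pair_code (code_fst n) (code_snd n) = n.
Proof.
have [m] := pfactor_coprime (isT : prime 2) (ltn0Sn n).
rewrite prime_coprime // dvdn2 negbK => m_odd def_n.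
have m_eq : m = (m./2).*2.+1 by rewrite -[LHS]odd_double_half m_odd.
have -> : code_snd n = m./2.
  by rewrite /code_snd /code_fst {2}def_n mulnC iter_half // subnn mul1n.
by apply: succn_inj; rewrite pair_codeS /code_fst -m_eq mulnC.
Qed.

Lemma rec_pair_code : rec2 pair_code.
Proof.
apply: (rec_ap1 rec_pred); apply: rec_ext (rec_ap2 (rec_iter rec_double)
  (rec_proj ord0) (rec_ap1 rec_succ (rec_ap1 rec_double (rec_proj ord_max)))).
move=> t /=; elim: (tnth t ord0) => [|x IHx]; first by rewrite mul1n.
by rewrite expnS -mulnA -IHx mul2n.
Qed.

Lemma rec_code_fst : rec1 code_fst.
Proof.
(* The valuation is the least number of halvings after which n + 1 becomes odd. *)
apply: (rec_min (f := fun t =>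
  1 - odd (iter (tnth t ord0) half (tnth t (lift ord0 ord0)).+1))).
  apply: (rec_ap2 rec_sub (rec_const _ _)); apply: (rec_ap1 rec_odd).
  apply: (rec_ap2 (rec_iter rec_half) (rec_proj _)).
  exact: (rec_ap1 rec_succ (rec_proj _)).
move=> t; rewrite !tnthS !tnth0; set n := tnth t ord0.
rewrite -(pair_codeK n) pair_codeS code_fstK.
split=> [|k ltk]; last rewrite !tnthS !tnth0 -/n -(pair_codeK n) pair_codeS.
  by rewrite iter_half // subnn mul1n /= odd_double.
by rewrite iter_half 1?ltnW // -(subnSK ltk) expnS -mulnA mul2n odd_double.
Qed.

Lemma rec_code_snd : rec1 code_snd.
Proof.
apply: (rec_ap1 rec_half); apply: (rec_ap2 (rec_iter rec_half)).
  exact: (rec_ap1 rec_code_fst (rec_proj _)).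
exact: (rec_ap1 rec_succ (rec_proj _)).
Qed.

(** * Computable functions between coded types *)

(** The coding is a bijection with [nat], so that every number decodes to an instance: a search
    through a coded type is a search through all numbers, without a test of validity. *)
Structure coded := Coded {
  coded_sort :> Type;
  enc : coded_sort -> nat;
  dec : nat -> coded_sort;
  encK : cancel enc dec;
  decK : cancel dec enc
}.

Canonical nat_coded := @Coded nat id id (frefl id) (frefl id).

Section CodedTypes.
Variables X Y : coded.

Definition prod_enc (p : X * Y) := pair_code (enc p.1) (enc p.2).
Definition prod_dec n : X * Y := (dec X (code_fst n), dec Y (code_snd n)).

Lemma prod_encK : cancel prod_enc prod_dec.
Proof. by case=> x y; rewrite /prod_dec code_fstK code_sndK !encK. Qed.

Lemma prod_decK : cancel prod_dec prod_enc.
Proof. by move=> n; rewrite /prod_enc !decK pair_codeK. Qed.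

Definition seq_enc (s : seq X) := CodeSeq.code (map (@enc X) s).
Definition seq_dec n : seq X := map (dec X) (CodeSeq.decode n).

Lemma seq_encK : cancel seq_enc seq_dec.
Proof. by move=> s; rewrite /seq_dec CodeSeq.codeK (mapK (@encK X)). Qed.

Lemma seq_decK : cancel seq_dec seq_enc.
Proof. by move=> n; rewrite /seq_enc (mapK (@decK X)) CodeSeq.decodeK. Qed.

End CodedTypes.

Canonical prod_coded (X Y : coded) :=
  Coded (@prod_encK X Y) (@prod_decK X Y).
Canonical seq_coded (X : coded) := Coded (@seq_encK X) (@seq_decK X).

Lemma enc_seq_nat (s : seq nat) : enc s = CodeSeq.code s.
Proof. by rewrite /enc /= /seq_enc map_id. Qed.

Lemma enc_cons (X : coded) (x : X) (s : seq X) :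
  enc (x :: s) = (pair_code (enc x) (enc s)).+1.
Proof. by rewrite pair_codeS. Qed.

Definition computable (X Y : coded) (f : X -> Y) : Prop :=
  rec1 (fun n => enc (f (dec X n))).

Section Computable.
Variables X Y Z : coded.
Implicit Types (f : X -> Y) (g : Y -> Z).

Lemma eq_computable f f' : f =1 f' -> computable f -> computable f'.
Proof. by move=> ff'; apply: rec_ext => t; rewrite ff'. Qed.

Lemma computable_id : computable (@id X).
Proof. by apply: rec_ext (rec_proj _) => t; rewrite decK. Qed.

Lemma computable_const (y : Y) : computable (fun _ : X => y).
Proof. exact: rec_const. Qed.

Lemma computable_comp g f :
  computable g -> computable f -> computable (fun x => g (f x)).
Proof.
by move=> cg cf; apply: rec_ext (rec_ap1 cg cf) => t; rewrite encK.
Qed.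

Lemma computable_pair f (h : X -> Z) :
  computable f -> computable h -> computable (fun x => (f x, h x)).
Proof. exact: rec_ap2 rec_pair_code. Qed.

Lemma computable_fst : computable (@fst X Y).
Proof. apply: rec_ext rec_code_fst => t. exact: (esym (@decK X _)). Qed.

Lemma computable_snd : computable (@snd X Y).
Proof. apply: rec_ext rec_code_snd => t; exact: (esym (@decK Y _)). Qed.

Lemma computable_enc : computable (@enc X).
Proof. by apply: rec_ext (rec_proj _) => t; rewrite decK. Qed.

Lemma computable_dec : computable (dec X).
Proof. by apply: rec_ext (rec_proj _) => t; rewrite decK. Qed.

Lemma computable_natrect (a : X -> Y) (n : X -> nat) (g : X * (nat * Y) -> Y) :
  computable a -> computable n -> computable g ->
  computable (fun x =>
    nat_rect (fun=> Y) (a x) (fun k y => g (x, (k, y))) (n x)).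
Proof.
move=> ca cn cg; pose G k r (t : 1.-tuple nat) :=
  enc (g (dec X (tnth t ord0), (k, dec Y r))).
apply: rec_ext (rec_natrect ca cn (g := G) _) => [t|].
  by elim: (n _) => //= k ->; rewrite /G encK.
apply: rec_ext (rec_ap1 cg
  (rec_ap2 rec_pair_code (rec_proj (lift ord0 (lift ord0 ord0)))
  (rec_ap2 rec_pair_code (rec_proj ord0) (rec_proj (lift ord0 ord0))))) => t.
rewrite /G tnth_mktuple /= /prod_dec !code_sndK !code_fstK /= /prod_dec.
by rewrite code_fstK code_sndK.
Qed.

End Computable.

Ltac computes_core :=
  match goal with
  | |- computable (fun x => x) => exact: computable_id
  | |- computable (fun x => ?c) => exact: computable_const
  | |- computable (fun x => (_, _)) => apply: computable_pair
  | |- computable (fun x => (@?f x).1) =>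
      apply: (computable_comp (@computable_fst _ _) (f := f))
  | |- computable (fun x => (@?f x).2) =>
      apply: (computable_comp (@computable_snd _ _) (f := f))
  | |- computable (fun x => enc (@?f x)) =>
      apply: (computable_comp (@computable_enc _) (f := f))
  | |- computable (fun x => dec _ (@?f x)) =>
      apply: (computable_comp (@computable_dec _) (f := f))
  | H : computable ?g |- computable (fun x => ?g (@?f x)) =>
      apply: (computable_comp H (f := f))
  end.

(* Redefined each time new computable operations become available. *)
Ltac computes_more := fail.

Ltac computes :=
  repeat first [computes_core | computes_more];
  try first [assumption | exact: computable_fst | exact: computable_snd].

(** * Closure properties of computable functions *)

Lemma computable_rec2 (X : coded) (f : nat -> nat -> nat) (a b : X -> nat) :
  rec2 f -> computable a -> computable b -> computable (fun x => f (a x) (b x)).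
Proof. exact: rec_ap2. Qed.

Lemma computable_succ (X : coded) (a : X -> nat) :
  computable a -> computable (fun x => (a x).+1).
Proof. exact: rec_ap1 rec_succ. Qed.

Lemma computable_natcase (X Y : coded) (a : X -> Y) (n : X -> nat)
    (g : X * nat -> Y) :
  computable a -> computable n -> computable g ->
  computable (fun x => if n x is k.+1 then g (x, k) else a x).
Proof.
move=> ca cn cg; pose G (p : X * (nat * Y)) := g (p.1, p.2.1).
apply: eq_computable (computable_natrect (g := G) ca cn _) => [x|].
  by case: (n x).
rewrite /G; computes.
Qed.

Lemma computable_iter (X Y : coded) (n : X -> nat) (a : X -> Y)
    (g : X * Y -> Y) :
  computable n -> computable a -> computable g ->
  computable (fun x => iter (n x) (fun y => g (x, y)) (a x)).
Proof.
move=> cn ca cg; pose G (p : X * (nat * Y)) := g (p.1, p.2.2).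
apply: eq_computable (computable_natrect (g := G) ca cn _) => [x|].
  by elim: (n x) => //= k ->.
rewrite /G; computes.
Qed.

Lemma computable_cons (X Y : coded) (a : X -> Y) (s : X -> seq Y) :
  computable a -> computable s -> computable (fun x => a x :: s x).
Proof.
move=> ca cs; apply: rec_ext (rec_ap1 rec_succ (rec_ap2 rec_pair_code ca cs)).
by move=> t; rewrite enc_cons.
Qed.

(** The empty list has code 0, and by [enc_cons] the code of a nonempty list is the successor of the
    code of the pair of its head and tail. Case analysis on a list is thus case analysis on its
    code. *)
Lemma computable_seqcase (X Y Z : coded) (a : X -> Z) (s : X -> seq Y)
    (g : X * (Y * seq Y) -> Z) :
  computable a -> computable s -> computable g ->
  computable (fun x => if s x is y :: s' then g (x, (y, s')) else a x).
Proof.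
move=> ca cs cg; pose G (p : X * nat) := g (p.1, dec _ p.2).
apply: eq_computable (computable_natcase (g := G) ca
  (computable_comp (computable_enc _) cs) _) => [x|].
  case: (s x) => [|y s'] //=.
  rewrite -[seq_enc _]/(enc (y :: s')) enc_cons /G /=.
  by rewrite /prod_dec code_fstK code_sndK !encK.
rewrite /G; computes.
Qed.

(** Every cons strictly increases the code. The code is a computable bound on the number of steps
    needed to traverse the list in [computable_foldl]. *)
Lemma size_leq_enc (X : coded) (s : seq X) : size s <= enc s.
Proof.
by elim: s => // x s IHs; rewrite enc_cons ltnS (leq_trans IHs) //
  -ltnS pair_codeS; nia.
Qed.

Lemma computable_foldl (X Y Z : coded) (a : X -> Y) (s : X -> seq Z)
    (g : X * (Y * Z) -> Y) :
  computable a -> computable s -> computable g ->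
  computable (fun x => foldl (fun y z => g (x, (y, z))) (a x) (s x)).
Proof.
move=> ca cs cg.
(* The state is the accumulator with the remaining list. [G] fixes a state whose list is empty, so
   iterating more often than the length does no harm. *)
pose G (p : X * (Y * seq Z)) : Y * seq Z :=
  if p.2.2 is z :: s' then (g (p.1, (p.2.1, z)), s') else p.2.
have GE x y (l : seq Z) n : size l <= n ->
    iter n (fun p => G (x, p)) (y, l) =
      (foldl (fun y z => g (x, (y, z))) y l, [::]).
  elim: n l y => [|n IHn] [|z l] y le_ln //; rewrite iterSr IHn //.
apply: eq_computable (computable_comp (computable_fst _ _)
 (computable_iter (n := fun x => enc (s x)) (a := fun x => (a x, s x)) (g := G)
    _ _ _)) => [x|||].
- by rewrite GE ?size_leq_enc.
- by computes.
- by computes.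
pose h (q : (X * (Y * seq Z)) * (Z * seq Z)) :=
  (g (q.1.1, (q.1.2.1, q.2.1)), q.2.2).
by apply: (computable_seqcase (g := h)); rewrite /h; computes.
Qed.

Lemma computable_rev (X Y : coded) (s : X -> seq Y) :
  computable s -> computable (fun x => rev (s x)).
Proof.
move=> cs; pose g (p : X * (seq Y * Y)) := p.2.2 :: p.2.1.
apply: eq_computable (computable_foldl (g := g) (computable_const _ [::]) cs _).
  move=> x; rewrite /g /rev; elim: (s x) [::] => //=.
by apply: computable_cons; computes.
Qed.

Lemma computable_cat (X Y : coded) (s t : X -> seq Y) :
  computable s -> computable t -> computable (fun x => s x ++ t x).
Proof.
move=> cs ct; pose g (p : X * (seq Y * Y)) := p.2.2 :: p.2.1.
apply: eq_computable (computable_foldl (g := g) ct (computable_rev cs) _).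
  by move=> x; rewrite foldl_rev /g; elim: (s x) => //= y l ->.
by apply: computable_cons; computes.
Qed.

Lemma computable_map (X Y Z : coded) (f : X * Y -> Z) (s : X -> seq Y) :
  computable f -> computable s ->
  computable (fun x => [seq f (x, y) | y <- s x]).
Proof.
move=> cf cs; pose g (p : X * (seq Z * Y)) := f (p.1, p.2.2) :: p.2.1.
apply: eq_computable (computable_foldl (g := g) (computable_const _ [::])
  (computable_rev cs) _) => [x|].
  by rewrite foldl_rev /g; elim: (s x) => //= y l ->.
by apply: computable_cons; rewrite /=; computes.
Qed.

Lemma computable_size (X Y : coded) (s : X -> seq Y) :
  computable s -> computable (fun x => size (s x)).
Proof.
move=> cs; pose g (p : X * (nat * Y)) := p.2.1.+1.
apply: eq_computable (computable_foldl (g := g) (computable_const _ 0) cs _).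
  move=> x; rewrite /g -[RHS]addn0; elim: (s x) 0 => //= y l IHl n.
  by rewrite IHl addSnnS.
by apply: computable_succ; computes.
Qed.

Lemma computable_nth (X Y : coded) y0 (s : X -> seq Y) (i : X -> nat) :
  computable s -> computable i -> computable (fun x => nth y0 (s x) (i x)).
Proof.
move=> cs ci.
have cbehead : computable (fun p : X * seq Y => behead p.2).
  apply: eq_computable (computable_seqcase (g := fun q => q.2.2)
    (computable_const _ [::]) (computable_snd X (seq_coded Y)) _) =>
    [[x []]|] //.
  by computes.
apply: eq_computable (computable_seqcase (g := fun q => q.2.1)
    (computable_const _ y0) (computable_iter ci cs cbehead) _) => [x|].
  elim: (i x) (s x) => [|n IHn] [|y l] //; rewrite iterSr IHn //=.
  exact: nth_nil.
by computes.
Qed.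

Ltac computes_ops :=
  match goal with
  | |- computable (fun x => _.+1) => apply: computable_succ
  | |- computable (fun x => _ - _) => apply: (computable_rec2 rec_sub)
  | |- computable (fun x => _ :: _) => apply: computable_cons
  | |- computable (fun x => _ ++ _) => apply: computable_cat
  | |- computable (fun x => rev _) => apply: computable_rev
  | |- computable (fun x => size _) => apply: computable_size
  | |- computable (fun x => nth _ _ _) => apply: computable_nth
  end.

Ltac computes_more ::= computes_ops.

Lemma computable_min (X : coded) (F : X * nat -> nat) :
  computable F -> (forall x, exists n, F (x, n) = 0) ->
  exists2 m : X -> nat, computable m & forall x, F (x, m x) = 0.
Proof.
move=> cF exF.
have exP x : exists n, F (x, n) == 0 by have [n /eqP] := exF x; exists n.
exists (fun x => ex_minn (exP x)) => [|x]; last by case: ex_minnP => n /eqP.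
apply: (rec_min (f := fun t =>
  F (dec X (tnth t (lift ord0 ord0)), tnth t ord0))).
  apply: rec_ext (rec_ap1 cF (rec_ap2 rec_pair_code (rec_proj (lift ord0 ord0))
    (rec_proj ord0))) => t.
  by rewrite /= /prod_dec code_fstK code_sndK.
move=> t /=; rewrite !tnthS !tnth0; case: ex_minnP => n /eqP Fn minn.
split=> // k ltk; rewrite !tnthS !tnth0 => /eqP /minn.
by rewrite leqNgt ltk.
Qed.

(** * Recursively enumerable predicates *)

(** The number k is a certificate for P x, and F is a total computable verifier that accepts with
    the value 0. *)
Definition re (X : coded) (P : X -> Prop) : Prop :=
  exists2 F : X * nat -> nat, computable F &
    forall x, P x <-> exists k, F (x, k) = 0.

Lemma re_witness (X W : coded) (P : X -> Prop) (F : X * W -> nat) :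
  computable F -> (forall x, P x <-> exists w, F (x, w) = 0) -> re P.
Proof.
move=> cF PF; exists (fun p => F (p.1, dec W p.2)); first by computes.
move=> x; rewrite PF; split=> [[w Fw]|[k Fk]]; last by exists (dec W k).
by exists (enc w); rewrite /= encK.
Qed.

Lemma re_ext (X : coded) (P Q : X -> Prop) :
  (forall x, P x <-> Q x) -> re P -> re Q.
Proof. by move=> PQ [F cF PF]; exists F => // x; rewrite -PQ. Qed.

Lemma re_comp (X Y : coded) (P : Y -> Prop) (f : X -> Y) :
  re P -> computable f -> re (fun x => P (f x)).
Proof.
move=> [F cF PF] cf; exists (fun p => F (f p.1, p.2)); first by computes.
by move=> x; rewrite PF.
Qed.

Lemma re_eq0 (X : coded) (f : X -> nat) : computable f -> re (fun x => f x = 0).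
Proof.
move=> cf; exists (fun p => f p.1) => [|x]; first by computes.
by split=> [|[]//]; exists 0.
Qed.

Lemma re_True (X : coded) : re (fun _ : X => True).
Proof. exact: re_ext (re_eq0 (computable_const _ 0)). Qed.

Lemma re_and (X : coded) (P Q : X -> Prop) :
  re P -> re Q -> re (fun x => P x /\ Q x).
Proof.
move=> [F cF PF] [G cG QG].
apply: (@re_witness _ (prod_coded nat_coded nat_coded) _ (fun p =>
  if F (p.1, p.2.1) is k.+1 then 1 else G (p.1, p.2.2))).
  by apply: (computable_natcase (g := fun=> 1)); computes.
move=> x; rewrite PF QG /=; split=> [[[k Fk] [l Gl]]|[[k l] /=]].
  by exists (k, l); rewrite /= Fk.
by case Fk: (F _) => // Gl; split; [exists k | exists l].
Qed.

Lemma re_or (X : coded) (P Q : X -> Prop) :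
  re P -> re Q -> re (fun x => P x \/ Q x).
Proof.
move=> [F cF PF] [G cG QG].
(* The first component of the certificate tells which disjunct is certified: 0 for P, any other
   number for Q. *)
apply: (@re_witness _ (prod_coded nat_coded nat_coded) _ (fun p =>
  if p.2.1 is k.+1 then G (p.1, p.2.2) else F (p.1, p.2.2))).
  by apply: (computable_natcase (g := fun q => G (q.1.1, q.1.2.2))); computes.
move=> x; rewrite PF QG /=; split=> [[[k Fk]|[k Gk]]|[[[|i] k] /= Ek]].
- by exists (0, k).
- by exists (1, k).
- by left; exists k.
- by right; exists k.
Qed.

Lemma re_ex (X Y : coded) (P : X -> Y -> Prop) :
  re (fun p : X * Y => P p.1 p.2) -> re (fun x => exists y, P x y).
Proof.
move=> [F cF PF].
apply: (@re_witness _ (prod_coded Y nat_coded) _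
  (fun p => F ((p.1, p.2.1), p.2.2))).
  by computes.
move=> x; split=> [[y /(PF (x, y))[k Fk]]|[[y k] Fk]]; first by exists (y, k).
by exists y; apply/(PF (x, y)); exists k.
Qed.

(** A certificate is the list of the certificates for all i below the bound. The recursion checks
    them in turn, and its accumulator stays nonzero after the first failure. *)
Lemma re_forall_lt (X : coded) (n : X -> nat) (P : X -> nat -> Prop) :
  computable n -> re (fun p : X * nat => P p.1 p.2) ->
  re (fun x => forall i, i < n x -> P x i).
Proof.
move=> cn [F cF PF].
pose step (q : X * seq nat * (nat * nat)) :=
  if q.2.2 is k.+1 then 1 else F (q.1.1, q.2.1, nth 0 q.1.2 q.2.1).
apply: (@re_witness _ (seq_coded nat_coded) _ (fun p => nat_rect (fun=> nat) 0
    (fun i acc => step (p, (i, acc))) (n p.1))).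
  apply: (computable_natrect (g := step)); try by computes.
  by apply: (computable_natcase (g := fun=> 1)); computes.
move=> x; rewrite /step {step} /=.
have natE (s : seq nat) m : nat_rect (fun=> nat) 0 (fun i acc =>
    match acc with 0 => F (x, i, nth 0 s i) | _.+1 => 1 end) m = 0 <->
    forall i, i < m -> F (x, i, nth 0 s i) = 0.
  elim: m => //= m; case: (nat_rect _ _ _ _) => [|k] IHm; last first.
    split=> // allF; suff: k.+1 = 0 by [].
    by apply/IHm => i lti; exact/allF/ltnW.
  split=> [Fm i|allF]; last exact: allF.
  by rewrite ltnS leq_eqVlt => /predU1P[->|lt_im] //; apply: IHm.1.
split=> [allP|[s /natE allF] i /allF Fi]; last first.
  by apply/(PF (x, i)); exists (nth 0 s i).
have /choice[k kP] i : exists k, i < n x -> F (x, i, k) = 0.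
  case: (ltnP i (n x)) => [lti|_]; last by exists 0.
  by have /(PF (x, i))[k Fk] := allP i lti; exists k.
by exists (mkseq k (n x)); apply/natE => i lti; rewrite nth_mkseq // kP.
Qed.

Lemma re_leq (X : coded) (a b : X -> nat) :
  computable a -> computable b -> re (fun x => a x <= b x).
Proof.
move=> ca cb; apply: re_ext (re_eq0 (f := fun x => a x - b x) _) => [x|].
  by rewrite -subn_eq0; split=> /eqP.
by computes.
Qed.

Lemma re_eq (X Y : coded) (a b : X -> Y) :
  computable a -> computable b -> re (fun x => a x = b x).
Proof.
move=> ca cb; have le_enc (f g : X -> Y) : computable f -> computable g ->
  re (fun x => enc (f x) <= enc (g x)) by move=> cf cg; apply: re_leq; computes.
apply: re_ext (re_and (le_enc _ _ ca cb) (le_enc _ _ cb ca)) => x.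
split=> [[le_ab le_ba]|->//]; apply: (can_inj (@encK Y)).
by apply/eqP; rewrite eqn_leq le_ab.
Qed.

Lemma re_neq (X Y : coded) (a b : X -> Y) :
  computable a -> computable b -> re (fun x => a x <> b x).
Proof.
move=> ca cb; have lt_enc (f g : X -> Y) : computable f -> computable g ->
  re (fun x => enc (f x) < enc (g x)) by move=> cf cg; apply: re_leq; computes.
apply: re_ext (re_or (lt_enc _ _ ca cb) (lt_enc _ _ cb ca)) => x.
split=> [+ eq_ab|neq_ab]; first by rewrite eq_ab ltnn => -[].
apply/orP; rewrite -neq_ltn; apply: contra_notN neq_ab => /eqP.
exact: (can_inj (@encK Y)).
Qed.

Lemma re_forall_seq (X : coded) (I : eqType) (s : seq I) (P : I -> X -> Prop) :
  (forall i, re (P i)) -> re (fun x => forall i, i \in s -> P i x).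
Proof.
move=> reP; elim: s => [|i s IHs]; first exact: re_ext (re_True X).
apply: re_ext (re_and (reP i) IHs) => x.
split=> [[Pi Ps] j|Ps]; last first.
  by split=> [|j js]; apply: Ps; rewrite inE ?eqxx ?js ?orbT.
by rewrite inE => /predU1P[->|/Ps].
Qed.

Lemma re_exists_seq (X : coded) (I : eqType) (s : seq I) (P : I -> X -> Prop) :
  (forall i, re (P i)) -> re (fun x => exists2 i, i \in s & P i x).
Proof.
move=> reP; elim: s => [|i s IHs].
  by apply: re_ext (re_eq0 (computable_const X 1)) => x; split=> // -[].
apply: re_ext (re_or (reP i) IHs) => x.
split=> [[Pi|[j js Pj]]|[j]]; first by exists i; rewrite ?inE ?eqxx.
  by exists j; rewrite // inE js orbT.
by rewrite inE => /predU1P[->|js] Pj; [left | right; exists j].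
Qed.

(* [T] carries both an [eqType] structure, for [\in], and the coding [Y]. *)
Section Membership.
Variables (X : coded) (T : eqType) (e : T -> nat) (d : nat -> T).
Variables (eK : cancel e d) (dK : cancel d e).
Let Y := Coded eK dK.

Lemma re_mem (a : X -> Y) (s : X -> seq Y) : computable a -> computable s ->
  re (fun x => (a x : T) \in (s x : seq T)).
Proof.
move=> ca cs.
apply: (re_ext (P := fun x =>
  exists i, i < size (s x) /\ nth (d 0) (s x) i = a x)).
  move=> x; split=> [[i [lti <-]]|/(nthP (d 0))[i]]; last by exists i.
  exact: mem_nth.
have csize : computable (fun x => size (s x)).
  exact: (computable_size (Y := Y)).
apply: re_ex; apply: re_and; first by apply: re_leq; computes.
apply: (re_eq (Y := Y)); last by computes.
by apply: (computable_nth (Y := Y)); computes.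
Qed.

Lemma re_forall_mem (s : X -> seq Y) (P : X -> T -> Prop) :
  computable s -> re (fun p : X * Y => P p.1 p.2) ->
  re (fun x => forall y, y \in (s x : seq T) -> P x y).
Proof.
move=> cs reP.
apply: (re_ext (P := fun x =>
  forall i, i < size (s x) -> P x (nth (d 0) (s x) i))).
  move=> x; split=> [Pnth y /(nthP (d 0))[i lti <-]|Ps i lti].
    exact: Pnth.
  exact/Ps/mem_nth.
apply: re_forall_lt; first exact: (computable_size (Y := Y)).
apply: (re_comp (Y := prod_coded X Y)
  (f := fun p => (p.1, nth (d 0) (s p.1) p.2))) reP _.
apply: (computable_pair (Z := Y)); first by computes.
by apply: (computable_nth (Y := Y)); computes.
Qed.

End Membership.

Definition re_mem_nat X :=
  @re_mem X nat _ _ (@encK nat_coded) (@decK nat_coded).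
Definition re_mem_seq_nat X :=
  @re_mem X (seq nat) _ _
    (@encK (seq_coded nat_coded)) (@decK (seq_coded nat_coded)).
Definition re_forall_mem_nat X :=
  @re_forall_mem X nat _ _ (@encK nat_coded) (@decK nat_coded).
Definition re_forall_mem_seq_nat X :=
  @re_forall_mem X (seq nat) _ _
    (@encK (seq_coded nat_coded)) (@decK (seq_coded nat_coded)).

(** The search runs through pairs of a value y and a certificate for P x y, and returns the first
    component of the first pair accepted. The existence hypothesis makes the search total. *)
Lemma computable_choice (X Y : coded) (P : X -> Y -> Prop) :
  re (fun p : X * Y => P p.1 p.2) -> (forall x, exists y, P x y) ->
  exists2 h : X -> Y, computable h & forall x, P x (h x).
Proof.
move=> [F cF PF] exP; pose W := prod_coded Y nat_coded.
have [||m cm Fm] := @computable_min X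
  (fun p => F (p.1, (dec W p.2).1, (dec W p.2).2)); first by computes.
  move=> x; have [y /(PF (x, y))[k Fk]] := exP x; exists (enc ((y, k) : W)).
  by rewrite encK.
exists (fun x => (dec W (m x)).1) => [|x]; first by computes.
by apply/(PF (x, (dec W (m x)).1)); exists (dec W (m x)).2; exact: Fm.
Qed.

(** A certificate is a finite chain from x to y in which neighbours are related by R in one
    direction or the other. *)
Lemma re_clos_rst (X : coded) (R : X -> X -> Prop) :
  re (fun p : X * X => R p.1 p.2) ->
  re (fun p : X * X => clos_refl_sym_trans X R p.1 p.2).
Proof.
move=> reR; pose R' x y := R x y \/ R y x.
have reR' : re (fun p : X * X => R' p.1 p.2).
  apply: re_or => //; apply: (re_comp (f := fun p => (p.2, p.1))) reR _.
  by computes.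
pose d := dec X 0.
have chainE x y : clos_refl_sym_trans X R x y <->
    exists s n, [/\ nth d s 0 = x, nth d s n = y &
      forall i, i < n -> R' (nth d s i) (nth d s i.+1)].
  rewrite clos_rst_rstn1_iff; split.
    elim=> [|y' z Ryz _ [s [n [s0 sn sR]]]]; first by exists [:: x], 0.
    (* The list [s] need not have exactly n + 1 entries, so it is rebuilt up to index n before z is
       appended. *)
    exists (mkseq (fun i => if i <= n then nth d s i else z) n.+2), n.+1.
    split=> [||i le_in]; rewrite ?nth_mkseq ?ltnn //; last exact: ltnW.
    rewrite ltnS in le_in; rewrite le_in.
    by case: ltngtP le_in => // [/sR|->] // _; rewrite sn.
  move=> [s [n [<- <- sR]]]; elim: n sR => [|n IHn] sR; first exact: rstn1_refl.
  by apply: rstn1_trans (sR n _) (IHn _) => // i ltin; apply/sR/ltnW.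
apply: re_ext (fun p => iff_sym (chainE p.1 p.2)) _.
apply: (@re_ex _ (seq_coded X)); apply: (@re_ex _ nat_coded).
pose R3 (q : X * X * seq X * nat) := nth d q.1.2 0 = q.1.1.1 /\
  (nth d q.1.2 q.2 = q.1.1.2 /\ forall i, i < q.2 ->
     R' (nth d q.1.2 i) (nth d q.1.2 i.+1)).
apply: (re_ext (P := R3)) => [q|]; first by split=> [[? []]|[]].
apply: re_and; first by apply: re_eq; computes.
apply: re_and; first by apply: re_eq; computes.
apply: re_forall_lt; first by computes.
apply: (re_comp
  (f := fun r => (nth d r.1.1.2 r.2, nth d r.1.1.2 r.2.+1))) reR' _.
by computes.
Qed.

Ltac enumerates_more := fail.
Ltac enumerates :=
  repeat match goal with
    | |- re (fun x => _ /\ _) => apply: re_and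
    | |- re (fun x => _ \/ _) => apply: re_or
    | |- re (fun x => exists y, _) => apply: re_ex
    | |- re (fun x => forall i, _) =>
        first [apply: re_forall_lt | apply: re_forall_seq => ?
              | apply: re_forall_mem_nat | apply: re_forall_mem_seq_nat]
    | |- re (fun x => is_true (_ <= _)) => apply: re_leq
    | |- re (fun x => is_true (_ \in _)) =>
        first [apply: re_mem_nat | apply: re_mem_seq_nat]
    | |- re (fun x => _ = _) => apply: re_eq
    | |- re (fun x => _ <> _) => apply: re_neq
    | _ => enumerates_more
    end; try solve [computes].

(** * Equality in M is recursively enumerable *)

Section Letters.
Variable B : finType.
Local Notation r := #|letter B|.

Definition letter_num (x : letter B) : nat := enum_rank x.
Definition num_letter n : option (letter B) :=
  omap enum_val (insub n : option 'I_r).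

Lemma letter_numK : pcancel letter_num num_letter.
Proof. by move=> x; rewrite /num_letter valK /= enum_rankK. Qed.

Lemma num_letter_out n : r <= n -> num_letter n = None.
Proof. by move=> le_rn; rewrite /num_letter insubF // ltnNge le_rn. Qed.

Lemma num_letterP n : n < r -> {x | n = letter_num x & num_letter n = Some x}.
Proof.
move=> ltn; exists (enum_val (Ordinal ltn)).
  by rewrite /letter_num enum_valK.
by rewrite /num_letter insubT.
Qed.

(** Words over a finite alphabet are handled as arbitrary lists of numbers, because a finite type
    cannot be in bijection with [nat] as [coded] demands. *)
Definition num_word : seq nat -> word (letter B) := pmap num_letter.
Definition word_num : word (letter B) -> seq nat := map letter_num.

Lemma word_numK : cancel word_num num_word.
Proof. exact: map_pK letter_numK. Qed.

Lemma word_numM u v : word_num (u * v)%g = word_num u ++ word_num v.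
Proof. exact: map_cat. Qed.

(** The default [r] is not the number of a letter, so numbers outside the alphabet stay outside it
    and [num_letter_inv] holds for every number. *)
Definition num_inv n :=
  nth r [seq letter_num (letter_inv x) | x <- enum (letter B)] n.

Lemma num_inv_letter x : num_inv (letter_num x) = letter_num (letter_inv x).
Proof.
by rewrite /num_inv (nth_map x) -?cardE ?ltn_ord // nth_enum_rank.
Qed.

Lemma num_inv_out n : r <= n -> num_inv n = r.
Proof. by move=> le_rn; rewrite /num_inv nth_default // size_map -cardE. Qed.

Lemma num_letter_inv n :
  num_letter (num_inv n) = omap (@letter_inv B) (num_letter n).
Proof.
case: (ltnP n r) => [/num_letterP[x -> ->]|le_rn].
  by rewrite num_inv_letter letter_numK.
by rewrite num_inv_out // !num_letter_out.
Qed.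

Definition inv_num (s : seq nat) := rev (map num_inv s).

Lemma num_word_inv s : num_word (inv_num s) = word_inv (num_word s).
Proof.
rewrite /num_word /inv_num /word_inv; elim: s => //= n s IHs.
rewrite rev_cons -cats1 pmap_cat IHs /= num_letter_inv.
by case: (num_letter n) => [x|] /=; rewrite ?cats0 // rev_cons -cats1.
Qed.

Lemma word_num_inv w : word_num (word_inv w) = inv_num (word_num w).
Proof.
rewrite /word_num /inv_num map_rev -!map_comp; congr rev.
by apply: eq_map => x /=; rewrite num_inv_letter.
Qed.

Lemma computable_num_inv : computable num_inv.
Proof. by apply: computable_nth; computes. Qed.

Lemma computable_inv_num : computable inv_num.
Proof.
apply: computable_rev; apply: (computable_map (f := fun p => num_inv p.2)).
  by have := computable_num_inv => ?; computes.
exact: computable_id.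
Qed.

End Letters.

Ltac computes_letters :=
  match goal with
  | |- computable (fun x => num_inv _ (@?f x)) =>
      refine (computable_comp (computable_num_inv _) (f := f) _)
  | |- computable (fun x => inv_num _ (@?f x)) =>
      refine (computable_comp (computable_inv_num _) (f := f) _)
  end.

Ltac computes_more ::= first [computes_ops | computes_letters].

(** * Equality in M as a rewriting relation on lists of numbers *)

Section Presentation.
Variables (M : monoidType) (B : finType).
Variable S : seq (word (letter B) * word (letter B)).
Variable pi : UMagmaMorphism.type (word (letter B)) M.
Hypothesis presM : inv_presentation S pi.
Local Notation r := #|letter B|.

Definition num_val (s : seq nat) : M := pi (num_word B s).

Lemma num_val_cat s t : num_val (s ++ t) = (num_val s * num_val t)%g.
Proof. by rewrite /num_val /num_word pmap_cat gmulfM. Qed.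

(* The numbers that are not letters are skipped by [num_word]; the last rule
   erases them, so that the rules capture [num_val] on all of [seq nat]. *)
Inductive num_rule : seq nat -> seq nat -> Prop :=
| num_rule_regular w : num_rule (w ++ inv_num B w ++ w) w
| num_rule_idem u v : num_rule (u ++ inv_num B u ++ v ++ inv_num B v)
                               (v ++ inv_num B v ++ u ++ inv_num B u)
| num_rule_rel e : e \in S -> num_rule (word_num e.1) (word_num e.2)
| num_rule_junk n : r <= n -> num_rule [:: n] [::].

Definition num_step (s t : seq nat) : Prop :=
  exists p q l m, [/\ s = p ++ l ++ q, t = p ++ m ++ q & num_rule l m].

Lemma rel_pi u v : inv_congruence S u v -> pi u = pi v.
Proof. by move/presM.2. Qed.

Lemma rho_pi u v : inverse_law u v -> pi u = pi v.
Proof. by move=> uv; apply/rel_pi/cg_base; left; apply: cg_base. Qed.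

Lemma num_rule_val l m : num_rule l m -> num_val l = num_val m.
Proof.
case=> [w|u v|e eS|n le_rn];
  rewrite /num_val /num_word ?pmap_cat -?/(num_word B _) ?num_word_inv.
- by rewrite catA; apply: rho_pi; apply: inverse_law_regular.
- by rewrite !catA; apply: rho_pi; apply: inverse_law_idem.
- by rewrite !word_numK; apply/rel_pi/cg_base; right; case: e eS.
- by rewrite /= num_letter_out.
Qed.

Lemma num_step_val s t : num_step s t -> num_val s = num_val t.
Proof.
by move=> [p [q [l [m [-> -> /num_rule_val lm]]]]]; rewrite !num_val_cat lm.
Qed.

Local Notation num_eq := (clos_refl_sym_trans (seq nat) num_step).

Lemma num_eq_cat p q s t : num_eq s t -> num_eq (p ++ s ++ q) (p ++ t ++ q).
Proof.
elim=> [{}s {}t [p' [q' [l [m [-> -> lm]]]]]|s'|s' t' _|s' t' u' _ IHst _].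
- by apply: rst_step; exists (p ++ p'), (q' ++ q), l, m; rewrite -!catA; split.
- exact: rst_refl.
- exact: rst_sym.
- exact: rst_trans.
Qed.

Lemma num_eq_mul s t s' t' :
  num_eq s t -> num_eq s' t' -> num_eq (s ++ s') (t ++ t').
Proof.
move=> /(num_eq_cat [::] s') st /(num_eq_cat t [::]); rewrite !cats0.
exact: rst_trans.
Qed.

Lemma num_eq_rule l m : num_rule l m -> num_eq l m.
Proof.
by move=> lm; apply: rst_step; exists [::], [::], l, m; rewrite !cats0.
Qed.

(** Stated for any generating relation, since [inv_congruence] is a congruence generated over
    another one, [rho]; the induction is used once at each level. *)
Lemma congruence_num (R : word (letter B) -> word (letter B) -> Prop) :
  (forall u v, R u v -> num_eq (word_num u) (word_num v)) ->
  forall u v, congruence_gen R u v -> num_eq (word_num u) (word_num v).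
Proof.
move=> RP u v.
elim=> [{}u {}v /RP //|w|w w' _|w w' w'' _ IH _ IH'|w w' x x' _ IH _ IH'].
- exact: rst_refl.
- exact: rst_sym.
- exact: rst_trans IH IH'.
- by rewrite !word_numM; apply: num_eq_mul.
Qed.

Lemma num_eq_num s : num_eq s (word_num (num_word B s)).
Proof.
elim: s => [|n s IHs]; first exact: rst_refl.
rewrite -cat1s /num_word pmap_cat /word_num map_cat; apply: num_eq_mul IHs.
case: (ltnP n r) => [/num_letterP[x -> /= eq_x]|le_rn /=].
  by rewrite letter_numK; apply: rst_refl.
by rewrite num_letter_out //; apply/num_eq_rule/num_rule_junk.
Qed.

(** Each step preserves the value. Conversely, both lists can be cleared of the numbers that are not
    letters; what remains are words, to which the presentation of M applies. *)
Lemma num_eqP s t : num_eq s t <-> num_val s = num_val t.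
Proof.
split; first by elim=> // [? ? /num_step_val|? ? ? _ ->].
move/presM.2 => st; apply: rst_trans (num_eq_num s) _.
apply: rst_trans (rst_sym _ _ _ _ (num_eq_num t)).
apply: congruence_num st => u v [uv|uvS]; last first.
  exact: num_eq_rule (num_rule_rel uvS).
apply: congruence_num uv => {u v}_ _ [w|u v];
  rewrite !word_numM !word_num_inv -!catA;
  apply: num_eq_rule.
- exact: num_rule_regular.
- exact: num_rule_idem.
Qed.

Lemma re_num_val_eq :
  re (fun p : seq nat * seq nat => num_val p.1 = num_val p.2).
Proof.
apply: re_ext (fun p => num_eqP p.1 p.2) (re_clos_rst _).
have reS : re (fun p : seq nat * seq nat =>
    exists2 e, e \in S & p.1 = word_num e.1 /\ p.2 = word_num e.2).
  by apply: re_exists_seq => e; enumerates.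
(* This is [num_step] with the inductive rules unfolded into existential quantifiers and
   connectives, the form that [enumerates] decomposes. *)
pose P (q : seq nat * seq nat) (p u l m : seq nat) :=
  q.1 = p ++ l ++ u /\ q.2 = p ++ m ++ u /\
  ((exists w, l = w ++ inv_num B w ++ w /\ m = w) \/
   (exists v w, l = v ++ inv_num B v ++ w ++ inv_num B w /\
                m = w ++ inv_num B w ++ v ++ inv_num B v) \/
   (exists2 e, e \in S & l = word_num e.1 /\ m = word_num e.2) \/
   (exists n, r <= n /\ l = [:: n] /\ m = [::])).
apply: (re_ext (P := fun q => exists p u l m, P q p u l m)) => [[s t]|].
  rewrite /P /num_step /=.
  split=> -[p [u [l [m]]]] => [[-> [-> lm]]|[-> -> lm]]; exists p, u, l, m.
    split=> //; case: lm => [[w [-> ->]]|]; first exact: num_rule_regular.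
    case=> [[v [w [-> ->]]]|]; first exact: num_rule_idem.
    by case=> [[e eS [-> ->]]|[n [rn [-> ->]]]]; constructor.
  do 2![split=> //]; case: lm => [w|v w|e eS|n rn]; first by left; exists w.
  - by right; left; exists v, w.
  - by right; right; left; exists e.
  - by right; right; right; exists n.
rewrite /P; enumerates.
by apply: (re_comp (f := fun x => (x.1.2, x.2))) reS _; computes.
Qed.

End Presentation.

(** * Inequality in M is recursively enumerable *)

Section WordInv.
Variable B : finType.

Lemma letter_invK : involutive (@letter_inv B).
Proof. by case. Qed.

Lemma word_invK : involutive (@word_inv B).
Proof.
move=> w; rewrite /word_inv map_rev revK -map_comp (eq_map letter_invK).
exact: map_id.
Qed.

Lemma word_inv_cons x (w : word (letter B)) :
  word_inv (x :: w) = word_inv w ++ [:: letter_inv x].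
Proof. by rewrite /word_inv /= rev_cons cats1. Qed.

Lemma word_inv_cat (u v : word (letter B)) :
  word_inv (u ++ v) = word_inv v ++ word_inv u.
Proof. by rewrite /word_inv map_cat rev_cat. Qed.

End WordInv.

(* An action of the letters on {0, ..., n - 1} by partial injections in which
   [0] stands for "undefined". *)
Section PartialInjections.
Variables (B : finType) (S : seq (word (letter B) * word (letter B))).
Variables (n : nat) (act : nat -> letter B -> nat).
Local Notation run := (foldl act).

Definition partial_injections : Prop :=
  [/\ forall x, act 0 x = 0,
      forall p x, p < n -> act p x < n &
      forall p x, p < n -> act p x = 0 \/ act (act p x) (letter_inv x) = p].

Hypothesis actP : partial_injections.
Hypothesis actS : forall p e, p < n -> e \in S -> run p e.1 = run p e.2.

Lemma run0 w : run 0 w = 0.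
Proof. by case: actP => act0 _ _; elim: w => //= x w; rewrite act0. Qed.

Lemma run_lt p w : p < n -> run p w < n.
Proof.
by case: actP => _ actn _; elim: w p => //= x w IHw p /actn/IHw.
Qed.

Lemma run_inv p w : p < n -> run p w <> 0 -> run (run p w) (word_inv w) = p.
Proof.
case: actP => act0 actn actV; elim: w p => //= x w IHw p ltpn.
rewrite word_inv_cons foldl_cat; have [->|actxV] := actV p x ltpn.
  by rewrite run0.
by move=> run_n0; rewrite IHw ?actn //=.
Qed.

(** By [run_inv], the word w w^-1 acts as the partial identity on the domain of w. This yields both
    laws of inverse monoids, because partial identities commute. *)
Lemma run_idem p w : p < n ->
  run p (w ++ word_inv w) = if run p w == 0 then 0 else p.
Proof.
move=> ltpn; rewrite foldl_cat; case: eqP => [->|]; first exact: run0.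
exact: run_inv.
Qed.

Lemma run_congruence u v :
  inv_congruence S u v -> forall p, p < n -> run p u = run p v.
Proof.
have mulP w w' x x' : (forall p, p < n -> run p w = run p w') ->
    (forall p, p < n -> run p x = run p x') ->
    forall p, p < n -> run p (w ++ x) = run p (w' ++ x').
  by move=> ww' xx' p ltpn; rewrite !foldl_cat ww' // xx' ?run_lt.
elim=> [{}u {}v [|uvS p ltpn]|//|w w' _ IH p ltpn|
        w w' x _ IH _ IH' p ltpn|w w' x x' _ IH _ IH'].
- elim=> [_ _ [w|{}u {}v] p ltpn|//|w w' _ IH p ltpn|
          w w' x _ IH _ IH' p ltpn|w w' x x' _ IH _ IH'].
  + change (run p ((w ++ word_inv w) ++ w) = run p w).
    by rewrite foldl_cat run_idem //; case: eqP => // ->; rewrite run0.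
  + change (run p (((u ++ word_inv u) ++ v) ++ word_inv v) =
            run p (((v ++ word_inv v) ++ u) ++ word_inv u)).
    (* The product of the two idempotents is the partial identity on the intersection of the
       domains, a condition symmetric in a and b. *)
    have runE a b : run p (((a ++ word_inv a) ++ b) ++ word_inv b) =
        if (run p a == 0) || (run p b == 0) then 0 else p.
      rewrite -catA foldl_cat (run_idem a ltpn).
      case: (run p a == 0) => /=; first exact: run0.
      exact: run_idem.
    by rewrite !runE orbC.
  + by rewrite IH.
  + by rewrite IH // IH'.
  + exact: mulP.
- exact: (actS (e := (u, v))).
- by rewrite IH.
- by rewrite IH // IH'.
- exact: mulP.
Qed.

End PartialInjections.

(** * Inversion in M *)

Section InverseMonoid.
Variables (M : monoidType) (B : finType).
Variable S : seq (word (letter B) * word (letter B)).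
Variable pi : UMagmaMorphism.type (word (letter B)) M.
Hypothesis inverseM : inverse_monoid M.
Hypothesis presM : inv_presentation S pi.
Local Open Scope group_scope.

(** An arbitrary word for m is inverted formally; [minv_pi] deduces from the uniqueness of inverses
    that the choice of the word does not matter. *)
Definition minv (m : M) : M := pi (word_inv (sval (cid (presM.1 m)))).

Lemma pi_regular w : pi w * pi (word_inv w) * pi w = pi w.
Proof.
by rewrite -!gmulfM; apply: (rho_pi presM); apply: inverse_law_regular.
Qed.

Lemma pi_regularV w :
  pi (word_inv w) * pi w * pi (word_inv w) = pi (word_inv w).
Proof. by have := pi_regular (word_inv w); rewrite word_invK. Qed.

Lemma minv_pi w : minv (pi w) = pi (word_inv w).
Proof.
rewrite /minv; case: cid => v /= eq_vw; have [a [_ uniq_a]] := inverseM (pi w).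
transitivity a; last by apply: uniq_a; rewrite pi_regular pi_regularV.
by apply/esym/uniq_a; rewrite -eq_vw pi_regular pi_regularV.
Qed.

Lemma pi_minv m : {w | m = pi w}.
Proof. by have [w <-] := cid (presM.1 m); exists w. Qed.

Lemma mulVm m : m * minv m * m = m.
Proof. by have [w ->] := pi_minv m; rewrite minv_pi pi_regular. Qed.

Lemma minvK : involutive minv.
Proof. by move=> m; have [w ->] := pi_minv m; rewrite !minv_pi word_invK. Qed.

Lemma mulmV m : minv m * m * minv m = minv m.
Proof. by rewrite -{2}[m]minvK mulVm. Qed.

Lemma minvM a b : minv (a * b) = minv b * minv a.
Proof.
have [[u ->] [v ->]] := (pi_minv a, pi_minv b).
by rewrite -gmulfM !minv_pi word_inv_cat gmulfM.
Qed.

Lemma idem_comm a b : a * minv a * (b * minv b) = b * minv b * (a * minv a).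
Proof.
have [[u ->] [v ->]] := (pi_minv a, pi_minv b).
rewrite !minv_pi !mulgA -!gmulfM; apply: (rho_pi presM).
exact: inverse_law_idem.
Qed.

(** The condition on the left says that s lies in the domain of b u, the one on the right that s
    lies in the domain of b and s b in that of u. This is the induction step that makes letterwise
    action agree with action by the whole word in [pw_run]. *)
Lemma mul_fix_cons s b u :
  (s * (b * u) * minv (b * u) == s) =
  (s * b * minv b == s) && (s * b * u * minv u == s * b).
Proof.
apply/eqP/andP => [fix_s|[/eqP fix_b /eqP fix_u]]; last first.
  by rewrite minvM !mulgA fix_u.
have fs : s * b * u * minv u * minv b = s by rewrite -[RHS]fix_s minvM !mulgA.
have bVb (x : M) : x * minv b * b * minv b = x * minv b.
  by rewrite -!mulgA (mulgA (minv b)) mulmV.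
have fix_b : s * b * minv b = s by rewrite -{1}fs bVb fs.
(* The idempotents u u^-1 and b^-1 b commute, which moves u u^-1 next to s b. *)
have ub : u * minv u * (minv b * b) = minv b * b * (u * minv u).
  by have := idem_comm u (minv b); rewrite minvK.
split; apply/eqP => //; rewrite -[in RHS]fs.
by rewrite -(mulgA _ (minv b)) -!(mulgA _ u) -(mulgA _ (u * _)) ub !mulgA fix_b.
Qed.

End InverseMonoid.

(* Preston--Wagner: a letter [x] maps [s] to [s x] whenever [s x x^-1 = s].
   The states are the elements of a finite list [F], shifted by one. *)
Section PrestonWagner.
Variables (M : monoidType) (B : finType).
Variable S : seq (word (letter B) * word (letter B)).
Variable pi : UMagmaMorphism.type (word (letter B)) M.
Hypothesis inverseM : inverse_monoid M.
Hypothesis presM : inv_presentation S pi.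
Local Open Scope group_scope.
Local Notation inv := (minv presM).
Variable F : seq M.
Hypothesis F_uniq : uniq F.
Hypothesis F_closed :
  forall s y, s \in F -> s * y * inv y = s -> s * y \in F.

Definition state (m : M) := (index m F).+1.

Definition pw_act p (x : letter B) : nat :=
  if p is i.+1 then
    let s := nth 1 F i in let y := pi [:: x] in
    if (i < size F)%N && (s * y * inv y == s) then state (s * y) else 0%N
  else 0%N.

Lemma pw_act_state s x : s \in F -> pw_act (state s) x =
  if s * pi [:: x] * inv (pi [:: x]) == s then state (s * pi [:: x]) else 0%N.
Proof. by move=> sF; rewrite /= index_mem sF nth_index. Qed.

Lemma state_lt s : s \in F -> (state s < (size F).+1)%N.
Proof. by rewrite ltnS index_mem. Qed.

Lemma state_inj s t : s \in F -> state s = state t -> s = t.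
Proof.
move=> sF [] eq_st; rewrite -(nth_index 1 sF) eq_st nth_index //.
by rewrite -index_mem -eq_st index_mem.
Qed.

Lemma stateP p : (p < (size F).+1)%N ->
  p = 0%N \/ exists2 s, s \in F & p = state s.
Proof.
case: p => [|i]; [by left | rewrite ltnS => lti; right].
by exists (nth 1 F i); rewrite ?mem_nth // /state index_uniq.
Qed.

Lemma pw_run0 w : foldl pw_act 0%N w = 0%N.
Proof. by elim: w. Qed.

Lemma pw_run s w : s \in F -> foldl pw_act (state s) w =
  if s * pi w * inv (pi w) == s then state (s * pi w) else 0%N.
Proof.
elim: w s => [|x w IHw] s sF.
  have -> : pi [::] = 1 by exact: gmulf1.
  have := mulVm inverseM presM 1; rewrite !mulg1 mul1g => ->.
  by rewrite mulg1 eqxx.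
have -> : foldl pw_act (state s) (x :: w) =
  foldl pw_act (pw_act (state s) x) w by [].
rewrite pw_act_state //.
have -> : pi (x :: w) = pi [:: x] * pi w by rewrite -gmulfM.
rewrite (mul_fix_cons inverseM).
case: (_ * inv (pi [:: x]) =P s) => [fix_x|_]; last exact: pw_run0.
by rewrite IHw ?F_closed // mulgA.
Qed.

Lemma pw_partial_injections : partial_injections (size F).+1 pw_act.
Proof.
split=> // p x /stateP[->|[s sF ->]] //; rewrite ?pw_act_state //; last 1 first.
- case: eqP => fix_x; [right | by left].
  rewrite pw_act_state ?F_closed //.
  have -> : pi [:: letter_inv x] = inv (pi [:: x]) by rewrite minv_pi.
  by rewrite fix_x (minvK inverseM) eqxx.
- by case: eqP => fix_x //; rewrite state_lt ?F_closed.
- by left.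
Qed.

Lemma pw_run_eq p u v : (p < (size F).+1)%N -> pi u = pi v ->
  foldl pw_act p u = foldl pw_act p v.
Proof.
by move=> /stateP[->|[s sF ->]] uv; rewrite ?pw_run0 // !pw_run // uv.
Qed.

(** At the state u u^-1 the word u is defined and leads to u. If v acts alike, then u = u u^-1 v,
    that is, u <= v in the natural partial order; by symmetry v <= u, and commuting idempotents give
    antisymmetry. *)
Lemma pw_separates u v :
  pi u * inv (pi u) \in F -> pi v * inv (pi v) \in F ->
  pi u \in F -> pi v \in F ->
  (forall p, (p < (size F).+1)%N -> foldl pw_act p u = foldl pw_act p v) ->
  pi u = pi v.
Proof.
have le_of a b : pi a * inv (pi a) \in F -> pi a \in F ->
    (forall p, (p < (size F).+1)%N -> foldl pw_act p a = foldl pw_act p b) ->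
    pi a = pi a * inv (pi a) * pi b.
  move=> eF aF /(_ _ (state_lt eF)).
  rewrite !pw_run // !(mulVm inverseM presM) eqxx.
  by case: eqP => // _; apply: state_inj.
move=> ueF veF uF vF uv; have le_uv := le_of _ _ ueF uF uv.
have le_vu := le_of _ _ veF vF (fun p ltp => esym (uv p ltp)).
rewrite le_uv {1}le_vu mulgA (idem_comm inverseM presM) -mulgA.
by rewrite (mulVm inverseM presM) -le_vu.
Qed.

End PrestonWagner.

(** * Finite actions given by tables *)

Section Tables.
Variables (M : monoidType) (B : finType).
Variable S : seq (word (letter B) * word (letter B)).
Variable pi : UMagmaMorphism.type (word (letter B)) M.
Hypothesis inverseM : inverse_monoid M.
Hypothesis presM : inv_presentation S pi.
Hypothesis finJM : finite_J_above M.
Local Notation r := #|letter B|.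
Local Notation val := (num_val pi).

(* All the numbers that are not letters are treated as the extra letter [r],
   which acts as the identity in a good table. *)
Definition clamp n := nth r (iota 0 r) n.

Lemma clamp_lt n : n < r -> clamp n = n.
Proof. by move=> ltn; rewrite /clamp nth_iota. Qed.

Lemma clamp_ge n : r <= n -> clamp n = r.
Proof. by move=> le_rn; rewrite /clamp nth_default // size_iota. Qed.

(** There is one row for each letter, indexed by the states. A missing row or entry reads as 0, the
    undefined state. *)
Definition tab_act (T : seq (seq nat)) p n := nth 0 (nth [::] T (clamp n)) p.
Definition tab_run T p (s : seq nat) := foldl (tab_act T) p s.

Lemma computable_tab_act :
  computable (fun q : seq (seq nat) * nat * nat => tab_act q.1.1 q.1.2 q.2).
Proof. by rewrite /tab_act /clamp; computes. Qed.

Lemma computable_tab_run :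
  computable (fun q : seq (seq nat) * nat * seq nat => tab_run q.1.1 q.1.2 q.2).
Proof.
pose g (q : seq (seq nat) * nat * seq nat * (nat * nat)) :=
  tab_act q.1.1.1 q.2.1 q.2.2.
apply: (computable_foldl (g := g)); computes.
by rewrite /g /tab_act /clamp; computes.
Qed.

(** All quantifiers are bounded, so the property can be enumerated. Among the relations of M only
    those in [S] are tested: partial injections satisfy the laws of inverse monoids by
    [run_congruence]. *)
Definition good_table (T : seq (seq nat)) n : Prop :=
  (forall b, b < r -> tab_act T 0 b = 0) /\
  (forall p, p < n -> tab_act T p r = p /\
    (forall b, b < r -> tab_act T p b < n /\
       (tab_act T p b = 0 \/ tab_act T (tab_act T p b) (num_inv B b) = p)) /\
    (forall e, e \in S ->
       tab_run T p (word_num e.1) = tab_run T p (word_num e.2))).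

Ltac computes_tables :=
  match goal with
  | |- computable (fun x => tab_act (@?T x) (@?p x) (@?n x)) =>
      refine (computable_comp computable_tab_act
                (f := fun x => (T x, p x, n x)) _)
  | |- computable (fun x => tab_run (@?T x) (@?p x) (@?s x)) =>
      refine (computable_comp computable_tab_run
                (f := fun x => (T x, p x, s x)) _)
  end.

Ltac computes_more ::=
  first [computes_ops | computes_letters | computes_tables].

Lemma re_good_table : re (fun q : seq (seq nat) * nat => good_table q.1 q.2).
Proof. by rewrite /good_table; enumerates. Qed.

Definition table_letter_act T p (x : letter B) := tab_act T p (letter_num x).

Lemma good_table_act T n :
  good_table T n -> partial_injections n (table_letter_act T).
Proof.
move=> [T0 Tn]; split=> [x|p x|p x]; first exact/T0/ltn_ord.
  by case/Tn=> _ [/(_ (letter_num x) (ltn_ord _))[]].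
by case/Tn=> _ [/(_ (letter_num x) (ltn_ord _))[_ +] _]; rewrite num_inv_letter.
Qed.

Lemma tab_run_letters T p w :
  tab_run T p (word_num w) = foldl (table_letter_act T) p w.
Proof. by elim: w p => //= x w IHw p; rewrite -IHw. Qed.

Lemma good_table_run T n p s : good_table T n -> p < n ->
  tab_run T p s = foldl (table_letter_act T) p (num_word B s).
Proof.
move=> Tn; have [_ act_lt _] := good_table_act Tn.
elim: s p => //= b s IHs p ltpn; rewrite /num_word /=.
case: (ltnP b r) => [/num_letterP[x -> /= eq_x]|le_rb].
  by rewrite letter_numK /= -IHs // act_lt.
rewrite num_letter_out // /= -IHs //; congr foldl.
by have [_ /(_ p ltpn)[+ _]] := Tn; rewrite /tab_act !clamp_ge.
Qed.

Lemma good_table_val T n s t : good_table T n -> val s = val t ->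
  forall p, p < n -> tab_run T p s = tab_run T p t.
Proof.
move=> Tn /presM.2 st p ltpn; rewrite !(good_table_run _ Tn) //.
apply: (run_congruence (good_table_act Tn)) st _ ltpn => {}p e ltpn eS.
by have [_ /(_ p ltpn)[_ [_ /(_ e eS)]]] := Tn; rewrite !tab_run_letters.
Qed.

(** The last row, at index [r], is the identity action of the extra letter. *)
Definition table_of n (act : nat -> letter B -> nat) :=
  rcons [seq [seq act p x | p <- iota 0 n] | x <- enum (letter B)] (iota 0 n).

Lemma table_ofE n act p x :
  p < n -> tab_act (table_of n act) p (letter_num x) = act p x.
Proof.
move=> ltpn; rewrite /tab_act clamp_lt ?ltn_ord // /table_of.
rewrite nth_rcons size_map -cardE ltn_ord (nth_map x) -?cardE ?ltn_ord //.
by rewrite nth_enum_rank (nth_map 0) ?size_iota // nth_iota.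
Qed.

Lemma table_of_run n act p w : partial_injections n act -> p < n ->
  tab_run (table_of n act) p (word_num w) = foldl act p w.
Proof.
move=> [_ act_lt _]; elim: w p => //= x w IHw p ltpn.
by rewrite -IHw ?act_lt // table_ofE.
Qed.

Lemma good_table_of n act : 0 < n -> partial_injections n act ->
  (forall p e, p < n -> e \in S -> foldl act p e.1 = foldl act p e.2) ->
  good_table (table_of n act) n.
Proof.
move=> n_gt0 actP actS; have [act0 act_lt actV] := actP.
split=> [b /num_letterP[x -> _]|p ltpn]; first by rewrite table_ofE.
split; last split.
- rewrite /tab_act clamp_ge // /table_of nth_rcons size_map -cardE ltnn eqxx.
  by rewrite nth_iota.
- move=> _ /num_letterP[x -> _].
  by rewrite num_inv_letter !table_ofE ?act_lt //; split=> //; apply: actV.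
- by move=> e eS; rewrite !table_of_run // actS.
Qed.

Lemma finite_factors m : exists F : seq M, forall u, u \in F <-> factor u m.
Proof.
have /finite_seqP[F FE] := finJM m; exists F => u.
by have /(congr1 (fun A => A u)) /= -> := FE.
Qed.

(** A good table gives equal runs to words of equal value, so a difference proves inequality.
    Conversely, the Preston-Wagner action on the factors of the two values, a finite set as M is
    finite-J-above, is tabulated and separates them by [pw_separates]. *)
Lemma num_val_neqP s t : val s <> val t <->
  exists T n p, [/\ good_table T n, p < n & tab_run T p s <> tab_run T p t].
Proof.
split; last first.
  move=> [T [n [p [Tn ltpn neq_st]]]] /good_table_val st.
  exact/neq_st/(st _ _ Tn).
move=> neq_st; apply: contrapT => noT; apply: neq_st.
have [Fs FsP] := finite_factors (val s).
have [Ft FtP] := finite_factors (val t).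
pose F := undup (Fs ++ Ft).
have FP u : u \in F <-> factor u (val s) \/ factor u (val t).
  rewrite mem_undup mem_cat.
  by split=> [/orP[/FsP|/FtP]|[/FsP->|/FtP->]]; rewrite ?orbT; auto.
(* Since u = (u y) y^-1, the element u y is a factor of everything of which u is a factor. *)
have F_closed u y : u \in F -> (u * y * minv presM y = u -> u * y \in F)%g.
  move=> /FP uF fix_u; apply/FP; have fuy m : factor u m -> factor (u * y)%g m.
    move=> [a [c ->]]; exists a, (minv presM y * c)%g.
    by rewrite -{1}fix_u !mulgA.
  by case: uF => /fuy; auto.
have FsF u : factor u (val s) -> u \in F by move=> ?; apply/FP; left.
have FtF u : factor u (val t) -> u \in F by move=> ?; apply/FP; right.
have factor_self m : factor m m by exists 1%g, 1%g; rewrite mulg1 mul1g.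
have factor_idem m : factor (m * minv presM m)%g m.
  by exists 1%g, m; rewrite mul1g (mulVm inverseM).
have F_uniq : uniq F := undup_uniq _.
have actP := pw_partial_injections inverseM F_uniq F_closed.
apply: (pw_separates inverseM (presM := presM) F_closed) => [||||p ltpn].
- exact/FsF/factor_idem.
- exact/FtF/factor_idem.
- exact/FsF/factor_self.
- exact/FtF/factor_self.
apply: contrapT => neq_p; apply: noT.
pose act := pw_act presM F.
have Tn : good_table (table_of (size F).+1 act) (size F).+1.
  apply: good_table_of => // q e ltqn eS; apply: pw_run_eq => //.
  by apply/(rel_pi presM)/cg_base; right; case: e eS.
exists (table_of (size F).+1 act), (size F).+1, p; split=> //.
by rewrite !(good_table_run _ Tn) // -!tab_run_letters !table_of_run.
Qed.

Lemma re_num_val_neq : re (fun q : seq nat * seq nat => val q.1 <> val q.2).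
Proof.
apply: (re_ext (P := fun q : seq nat * seq nat => exists T n p,
  good_table T n /\ n > p /\ tab_run T p q.1 <> tab_run T p q.2)) => [q|].
  rewrite num_val_neqP; split=> -[T [n [p]]].
    by case=> ? []; exists T, n, p.
  by case=> *; exists T, n, p.
enumerates.
by apply: (re_comp (f := fun x => (x.1.1.2, x.1.2))) re_good_table _; computes.
Qed.

End Tables.

(** * Certified automata *)

Section Automata.
Variable A : finType.

(** Automata stripped of the bounds on states and letters, so that they form a coded type. A value
    may be ill-formed; a certificate excludes this. *)
Definition raw_automaton : Type := nat * (seq nat * (seq nat * seq (seq nat))).

Definition raw_code (N : raw_automaton) : nat :=
  CodeSeq.code [:: N.1; CodeSeq.code N.2.1; CodeSeq.code N.2.2.1;
                   CodeSeq.code (map CodeSeq.code N.2.2.2)].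

Lemma computable_raw_code :
  computable (raw_code : nat * (seq nat * (seq nat * seq (seq nat))) -> nat).
Proof.
apply: (eq_computable (f :=
  fun N : nat * (seq nat * (seq nat * seq (seq nat))) =>
  enc [:: N.1; enc N.2.1; enc N.2.2.1; enc N.2.2.2])); last by computes.
move=> N; rewrite /raw_code !enc_seq_nat.
congr (CodeSeq.code [:: _; _; _; CodeSeq.code _]).
by apply: eq_map => s; apply: enc_seq_nat.
Qed.

Definition edge_code k (e : 'I_k * A * 'I_k) : seq nat :=
  [:: val e.1.1; val (enum_rank e.1.2); val e.2].

Lemma map_onto (X Y : eqType) (g : Y -> X) (s : seq X) :
  (forall x, x \in s -> exists y, g y = x) -> exists s', map g s' = s.
Proof.
elim: s => [|x s IHs] gs; first by exists [::].
have [y <-] := gs x (mem_head _ _).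
have [|s' <-] := IHs; last by exists (y :: s').
by move=> z zs; apply: gs; rewrite inE zs orbT.
Qed.

Section Recognition.
Variables (M : monoidType) (phi : UMagmaMorphism.type (word A) M) (m : M).
Variables (N : automaton A) (sg : 'I_(nstates N) -> M).
Local Open Scope group_scope.

Hypothesis init1 : forall p, p \in initial N -> sg p = 1.
Hypothesis init_ex : exists p, p \in initial N.
Hypothesis terminalP : forall p, p \in terminal N <-> sg p = m.
Hypothesis edgesP : forall p a q,
  (p, a, q) \in edges N -> sg p * phi [:: a] = sg q.
Hypothesis edge_ex : forall p a,
  (exists q, (p, a, q) \in edges N) \/ (forall y, sg p * phi [:: a] * y <> m).

Lemma phi_cons a w : phi (a :: w) = phi [:: a] * phi w.
Proof. by rewrite -gmulfM. Qed.

Lemma run_sg p w q : run p w q -> sg q = sg p * phi w.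
Proof.
elim: w p => [|a w IHw] p /=.
  by move=> ->; rewrite (_ : phi [::] = 1) ?mulg1 //; apply: gmulf1.
by case=> s /edgesP eq_s /IHw->; rewrite phi_cons mulgA eq_s.
Qed.

(** A run multiplies the label [sg] on the right by the image of the word read. The prefixes of a
    word with image m stay among the left divisors of m, where the edges exist. Several states may
    carry the same label. *)
Lemma recognized_sg : recognized N = [set w | phi w = m]%classic.
Proof.
apply/seteqP; split=> w /=.
  by case=> p [q [/init1 p1 /terminalP <- /run_sg ->]]; rewrite p1 mul1g.
move=> wm; have [p0 p0i] := init_ex.
suff [q qt pq] : exists2 q, q \in terminal N & run p0 w q by exists p0, q.
have : sg p0 * phi w = m by rewrite init1 // mul1g.
elim: w p0 {p0i wm} => [|a w IHw] p.
  have -> : phi [::] = 1 by exact: gmulf1.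
  by rewrite mulg1 => /terminalP; exists p.
rewrite phi_cons mulgA; case: (edge_ex p a) => [[q pq]|no_y /no_y//].
by rewrite (edgesP pq) => /IHw[t tt qt]; exists t => //=; exists q.
Qed.

End Recognition.
End Automata.

(** * Correctness certificates for automata recognizing a fibre of [phi] *)

Section Certificate.
Variables (M : monoidType) (B A : finType).
Variable S : seq (word (letter B) * word (letter B)).
Variable pi : UMagmaMorphism.type (word (letter B)) M.
Variable phi : UMagmaMorphism.type (word A) M.
Hypothesis inverseM : inverse_monoid M.
Hypothesis presM : inv_presentation S pi.
Hypothesis finJM : finite_J_above M.
Local Notation val := (num_val pi).
Local Open Scope group_scope.

Variable gens : seq (seq nat).
Hypothesis gensP : forall a : A, val (nth [::] gens (enum_rank a)) = phi [:: a].

Lemma num_val_inv s : val (inv_num B s) = minv presM (val s).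
Proof. by rewrite /num_val num_word_inv (minv_pi inverseM). Qed.

Lemma num_val_onto x : exists s, val s = x.
Proof.
by have [w <-] := presM.1 x; exists (word_num w); rewrite /num_val word_numK.
Qed.

(** Equality and inequality in M are given names so that [enumerates] tells them from equality and
    inequality of coded data. *)
Definition num_eq s t := val s = val t.
Definition num_neq s t := val s <> val t.

Lemma re_num_eq (X : coded) (s t : X -> seq nat) :
  computable s -> computable t -> re (fun x => num_eq (s x) (t x)).
Proof.
move=> cs ct.
apply: (re_comp (f := fun x => (s x, t x))) (re_num_val_eq presM) _.
by computes.
Qed.

Lemma re_num_neq (X : coded) (s t : X -> seq nat) :
  computable s -> computable t -> re (fun x => num_neq (s x) (t x)).
Proof.
move=> cs ct.
apply: (re_comp (f := fun x => (s x, t x)))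
  (re_num_val_neq inverseM presM finJM) _.
by computes.
Qed.

(* The list [xs] gives for each state of [N] a word for the element of [M] that
   it represents.  The last clause makes the transitions that are absent from
   [N] leave the set of left divisors of the element [s]. *)
Definition certifies (s : seq nat) (N : raw_automaton) (xs : seq (seq nat)) :
    Prop :=
  let k := N.1 in let I := N.2.1 in let T := N.2.2.1 in let E := N.2.2.2 in
  let x := nth [::] xs in let y i a := x i ++ nth [::] gens a in
  (0 < size I /\
   (forall i, i \in I -> i < k /\ num_eq (x i) [::]) /\
   (forall i, i \in T -> i < k /\ num_eq (x i) s) /\
   (forall i, i < k -> i \in T \/ num_neq (x i) s) /\
   (forall e, e \in E -> exists i a j,
      i < k /\ a < #|A| /\ j < k /\ e = [:: i; a; j] /\ num_eq (y i a) (x j)) /\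
   (forall i, i < k -> forall a, a < #|A| ->
      (exists j, [:: i; a; j] \in E) \/
      num_neq (y i a ++ inv_num B (y i a) ++ s) s))%N.

Ltac enumerates_more ::=
  match goal with
  | |- re (fun x => num_eq _ _) => apply: re_num_eq
  | |- re (fun x => num_neq _ _) => apply: re_num_neq
  end.

Lemma re_certifies :
  re (fun q : seq nat * (nat * (seq nat * (seq nat * seq (seq nat)))) =>
    exists xs, certifies q.1 q.2 xs).
Proof.
rewrite /certifies /=; apply: (@re_ex _ (seq_coded (seq_coded nat_coded))).
by enumerates.
Qed.

Lemma certifies_sound s N xs : certifies s N xs ->
  exists2 N' : automaton A, automaton_code N' = raw_code N &
    recognized N' = [set w | phi w = val s]%classic.
Proof.
case: N => k [I [T E]] [/= I_gt0 [IP [TP [allT [EP allE]]]]].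
(* The bounds in the certificate lift the raw numbers to ordinals and letters. *)
have [I' eqI] : exists I' : seq 'I_k, map \val I' = I.
  by apply: map_onto => i /IP[ltik _]; exists (Ordinal ltik).
have [T' eqT] : exists T' : seq 'I_k, map \val T' = T.
  by apply: map_onto => i /TP[ltik _]; exists (Ordinal ltik).
have [E' eqE] : exists E' : seq ('I_k * A * 'I_k), map (@edge_code A k) E' = E.
  apply: map_onto => e /EP[i [a [j [lti [lta [ltj [-> _]]]]]]].
  exists (Ordinal lti, enum_val (Ordinal lta), Ordinal ltj).
  by rewrite /edge_code /= enum_valK.
have edge_code_inj : injective (@edge_code A k).
  move=> [[i a] j] [[i' a'] j'] [].
  by move=> /val_inj-> /val_inj/enum_rank_inj-> /val_inj->.
have edgeP (i : 'I_k) (a : A) (j : 'I_k) :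
    ((i, a, j) \in E') =
    ([:: nat_of_ord i; nat_of_ord (enum_rank a); nat_of_ord j] \in E).
  by rewrite -eqE -(mem_map edge_code_inj).
exists (Automaton I' T' E').
  rewrite /automaton_code /raw_code /= eqI eqT.
  congr (CodeSeq.code [:: _; _; _; CodeSeq.code _]).
  by rewrite -eqE -map_comp.
pose sg (i : 'I_k) := val (nth [::] xs i).
have xaE (i : 'I_k) a : val (nth [::] xs i ++ nth [::] gens (enum_rank a)) =
    sg i * phi [:: a] by rewrite num_val_cat gensP.
have val0 : val [::] = 1 by exact: gmulf1.
apply: (@recognized_sg A M phi (val s) (Automaton I' T' E') sg) =>
  [i iI||i|i a j|i a].
- by rewrite -val0; apply: (IP i _).2; rewrite -eqI; apply: map_f.
- move: I_gt0; rewrite -eqI size_map; case: (I') => // i I'' _.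
  by exists i; apply: mem_head.
- rewrite -[i \in _](mem_map val_inj) /= eqT; split=> [/TP[]//|eq_i].
  by have [//|] := allT i (ltn_ord i).
- rewrite [_ \in _]edgeP => /EP[i' [a' [j' [_ [_ [_ [[<- <- <-] eq_j]]]]]]].
  by rewrite -xaE.
- have [[j ij]|neq_s] := allE i (ltn_ord i) (enum_rank a) (ltn_ord _).
    have [_ [_ [j' [_ [_ [ltj [[_ _ eq_j] _]]]]]]] := EP _ ij.
    left; exists (Ordinal ltj); rewrite [_ \in _]edgeP /= -eq_j; exact: ij.
  (* If s = z y in M, then z z^-1 s = s; hence the certified inequality excludes z as a left divisor
     of s. *)
  right=> y eq_s; apply: neq_s.
  rewrite num_val_cat (num_val_cat _ (inv_num _ _)) num_val_inv xaE -eq_s.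
  by move: (sg i * phi [:: a]) => z; rewrite !mulgA (mulVm inverseM).
Qed.

(** The states are the left divisors of the value of s, finitely many because they are factors of
    it, and every triple compatible with multiplication in M is taken as an edge. *)
Lemma certifies_complete s : exists N xs, certifies s N xs.
Proof.
have [F FP] := finite_factors finJM (val s).
pose Ps := [seq p <- F | `[< exists y, p * y = val s >]].
have PsP p : p \in Ps <-> exists y, p * y = val s.
  rewrite mem_filter; split=> [/andP[/asboolP//]|py].
  apply/andP; split; first exact/asboolP.
  by apply/FP; case: py => y <-; exists 1, y; rewrite mul1g.
have [rep repP] := choice num_val_onto.
pose k := size Ps; pose sg i := nth 1 Ps i.
have sgP p : p \in Ps -> exists2 i, (i < k)%N & sg i = p by move/(nthP 1).
pose xs := map rep Ps.
have xsE i : (i < k)%N -> val (nth [::] xs i) = sg i.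
  by move=> lti; rewrite (nth_map 1) // repP.
pose good_edge e :=
  val (nth [::] xs (nth 0%N e 0) ++ nth [::] gens (nth 0%N e 1)) ==
  val (nth [::] xs (nth 0%N e 2)).
pose I := [seq i <- iota 0 k | sg i == 1].
pose T := [seq i <- iota 0 k | sg i == val s].
pose E := [seq e <- [seq [:: ia.1; ia.2; j] |
  ia <- [seq (i, a) | i <- iota 0 k, a <- iota 0 #|A|], j <- iota 0 k] |
  good_edge e].
have val0 : val [::] = 1 by exact: gmulf1.
have E_in i a j : (i < k)%N -> (a < #|A|)%N -> (j < k)%N ->
    val (nth [::] xs i ++ nth [::] gens a) = val (nth [::] xs j) ->
    [:: i; a; j] \in E.
  move=> lti lta ltj eq_j; rewrite mem_filter; apply/andP.
  split; first exact/eqP.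
  apply/allpairsP; exists ((i, a), j); split; rewrite ?mem_iota //.
  by apply/allpairsP; exists (i, a); split; rewrite ?mem_iota.
exists (k, (I, (T, E))), xs.
split=> /=; last (split; last (split; last (split; last split))).
- have [|i lti sg_i] := sgP 1.
    by apply/PsP; exists (val s); rewrite mul1g.
  suff : i \in I by case: (I).
  by rewrite mem_filter sg_i eqxx mem_iota.
- move=> i; rewrite mem_filter mem_iota => /andP[/eqP sg_i lti].
  by split=> //; rewrite /num_eq xsE // val0.
- move=> i; rewrite mem_filter mem_iota => /andP[/eqP sg_i lti].
  by split=> //; rewrite /num_eq xsE.
- move=> i lti; case: (sg i =P val s) => [/eqP sg_i|neq_i]; [left | right].
    by rewrite mem_filter sg_i mem_iota.
  by rewrite /num_neq xsE.
- move=> e; rewrite mem_filter => /andP[/eqP eq_e /allpairsP[[ia j] /= []]].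
  case/allpairsP=> -[i a] /= []; rewrite !mem_iota => lti lta -> ltj eq_ej.
  by exists i, a, j; rewrite eq_ej in eq_e *.
- move=> i lti a lta; set y := nth [::] xs i ++ nth [::] gens a.
  have [yP|yP] := pselect (exists z, val y * z = val s).
    have [j ltj sg_j] := sgP _ ((PsP _).2 yP).
    by left; exists j; apply: E_in => //; rewrite xsE.
  (* If y y^-1 s = s, then y^-1 s is a right cofactor that makes y a left divisor of s. *)
  right=> eq_s; apply: yP; exists (minv presM (val y) * val s).
  by rewrite -num_val_inv -!num_val_cat.
Qed.

End Certificate.

(** * The decision procedure *)

Local Open Scope classical_set_scope.

Theorem theorem3p10 (M : monoidType) (B : finType)
    (S : seq (word (letter B) * word (letter B)))
    (pi : UMagmaMorphism.type (word (letter B)) M)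
    (inverseM : inverse_monoid M)
    (presM : inv_presentation S pi)
    (finJM : finite_J_above M)
    (A : finType)
    (phi : UMagmaMorphism.type (word A) M)
    (L : set (word A))
    (decL : rational_emptiness_decidable L) :
  membership_decidable pi (phi @` L).
Proof.
have [f rec_f fP] := decL.
have [g gP] := choice (fun a : A => num_val_onto presM (phi [:: a])).
pose gens := [seq g a | a <- enum A].
have gensP a : num_val pi (nth [::] gens (enum_rank a)) = phi [:: a].
  by rewrite (nth_map a) -?cardE // nth_enum_rank gP.
(* Unbounded search for a certified automaton; completeness of the certificates ensures that it
   stops on every list [s]. *)
have [h ch hP] := computable_choice (re_certifies A inverseM presM finJM gens)
  (certifies_complete A inverseM presM finJM gens).
pose f1 n := f [tuple n].
have cf1 : computable f1.
  apply: rec_ext rec_f => t; congr f; apply: eq_from_tnth => i.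
  by rewrite (ord1 i) tnth0.
have craw := computable_raw_code.
(* Membership means nonemptiness, so the answer of [f] is negated: 1 becomes 0, while 0 becomes 1
   and any value above 1 falls on the default 1. *)
pose G s := nth 1 [:: 1; 0] (f1 (raw_code (h s))).
have cG : computable G.
  apply: (computable_nth _ (computable_const _ _)).
  apply: (computable_comp cf1); exact: (computable_comp craw).
exists (fun t => G (dec _ (tnth t ord0))); first exact: cG.
move=> w; rewrite tnth0.
(* The input code of a word is the code of its list of letter numbers. *)
have -> : dec (seq_coded nat_coded) (word_code w) = word_num w.
  rewrite -[RHS]encK; congr dec; exact/esym/enc_seq_nat.
have [xs] := hP (word_num w).
move=> /(certifies_sound inverseM presM gensP)[N codeN recN].
rewrite /G -codeN; have {}fP := fP N; rewrite recN /num_val word_numK in fP.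
have -> : (nth 1 [:: 1; 0] (f1 (automaton_code N)) = 1) <->
    ~ (f1 (automaton_code N) = 1).
  by case: (f1 _) => [|[|n]] //=; rewrite nth_nil.
rewrite -fP; split=> [[u Lu uw] LR0|LR_n0].
  by have : (L `&` [set u | phi u = pi w]) u by []; rewrite LR0.
have /set0P[u [Lu uw]] : L `&` [set u | phi u = pi w] != set0 by exact/eqP.
by exists u.
Qed.
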